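(* Let $X$ be a (real) Hilbert space and $G:X\to X^*$ a nonlinear operator. Assume that there exists a linear isomorphism $Q:X\to X$ such that $Q^*G:X\to X^*$ is Lipschitz continuous and uniformly monotone. Furthermore, let $P:X\to X^*$ be any linear operator that is bounded, symmetric and coercive. Then $G$ is bijective, and for every $\chi\in X^*$, $\eta^0\in X$, and a sufficiently small $s>0$ the iteration $$\eta^{n+1}=\eta^n+s\,P^{-1}Q^*(\chi-G\eta^n)$$ converges to $\eta$, the solution of $G\eta=\chi$. The convergence is linear, i.e., there exist constants $C>0$ and $L\in(0,1)$ such that $$\|\eta^n-\eta\|_X\le CL^n\|\eta^0-\eta\|_X.$$
   Context: $X^*$ is the dual of $X$ and $\langle\cdot,\cdot\rangle$ the dual pairing on $X^*\times X$. For a linear isomorphism $Q:X\to X$ (a bounded linear bijection with bounded inverse), the adjoint $Q^*:X^*\to X^*$ is $u\mapsto\langle u,Q\,\cdot\rangle$. An operator $K:X\to X^*$ is Lipschitz continuous if there is $C>0$ with $\|Ku-Kv\|_{X^*}\le C\|u-v\|_X$ for all $u,v\in X$, and uniformly monotone if there is $c>0$ with $\langle Ku-Kv,u-v\rangle\ge c\|u-v\|_X^2$ for all $u,v\in X$. A linear operator $P:X\to X^*$ is symmetric if $\langle P\eta,\mu\rangle=\langle P\mu,\eta\rangle$ for all $\eta,\mu\in X$, and coercive if it is uniformly monotone. *)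

(* Defs.v *)
From HB Require Import structures.
From mathcomp Require Import all_boot all_order all_algebra.
From mathcomp Require Import all_classical all_reals all_analysis.

Set Implicit Arguments.
Unset Strict Implicit.
Unset Printing Implicit Defensive.

Import Order.TTheory GRing.Theory Num.Theory.
Import numFieldNormedType.Exports.

Local Open Scope classical_set_scope.
Local Open Scope ring_scope.

Section DualSpace.
Context {R : realType} {X : normedModType R}.

Definition dual_pred : {pred (X -> R^o)} :=
  fun f => `[< linear f /\ continuous f >].

Lemma dual_pred_submod : submod_closed dual_pred.
Proof.
split=> [|a f g].
  apply/asboolP; split; last exact: cst_continuous.
  by move=> k x y /=; rewrite /GRing.zero /= scaler0 addr0.
move=> /asboolP[lf cf] /asboolP[lg cg]; apply/asboolP; split.
  move=> k x y; rewrite !fctE lf lg !scalerDr addrACA.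
  by congr (_ + _ + _); rewrite !scalerA mulrC.
move=> x; apply: continuousD; last exact: cg.
by apply: continuousZl_tmp; exact: cf.
Qed.

HB.instance Definition _ := GRing.isSubmodClosed.Build R (X -> R^o) dual_pred
  dual_pred_submod.

(* The dual pairing <u, x> is the application [u x]. *)
Record dual_space := DualSpace {
  dual_fun :> X -> R^o ;
  dual_funP : dual_fun \in dual_pred }.

HB.instance Definition _ := [isSub for dual_fun].
HB.instance Definition _ := [Choice of dual_space by <:].
HB.instance Definition _ := [SubChoice_isSubLmodule of dual_space by <:].

Lemma dual_linear (u : dual_space) : linear u.
Proof. by have /asboolP[] := dual_funP u. Qed.

Lemma dual_continuous (u : dual_space) : continuous u.
Proof. by have /asboolP[] := dual_funP u. Qed.

HB.instance Definition _ (u : dual_space) :=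
  GRing.isLinear.Build R X R^o *:%R (dual_fun u) (dual_linear u).

Definition dual_norm (u : dual_space) : R :=
  sup [set `|u x| | x in [set x | `|x| <= 1]].

Lemma dual_norm_has_sup (u : dual_space) :
  has_sup [set `|u x| | x in [set x | `|x| <= 1]].
Proof.
split; first by exists `|u 0|; exists 0 => //=; rewrite normr0.
have /linear_boundedP/pinfty_ex_gt0[M M0 uM] :
  bounded_near (dual_fun u) (nbhs 0).
  by apply: continuous_linear_bounded; exact: dual_continuous.
exists M => _ [x /= x1 <-]; apply: (le_trans (uM x)).
by rewrite -[leRHS]mulr1 ler_pM2l.
Qed.

Lemma dual_norm_ge0 (u : dual_space) : 0 <= dual_norm u.
Proof.
apply: (@le_trans _ _ `|u 0|) => //.
apply: sup_upper_bound; first exact: dual_norm_has_sup.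
by exists 0 => //=; rewrite normr0.
Qed.

Lemma le_dual_norm (u : dual_space) (x : X) : `|u x| <= dual_norm u * `|x|.
Proof.
have [->|x0] := eqVneq x 0; first by rewrite linear0 !normr0 mulr0.
have x_gt0 : 0 < `|x| by rewrite normr_gt0.
rewrite -ler_pdivrMr //.
have -> : `|u x| / `|x| = `|u (`|x|^-1 *: x)|.
  by rewrite linearZ normrZ mulrC normfV normr_id.
apply: sup_upper_bound; first exact: dual_norm_has_sup.
by exists (`|x|^-1 *: x) => //=; rewrite normrZ normfV normr_id mulVf ?gt_eqF.
Qed.

Lemma dual_norm_le (u : dual_space) (M : R) :
  (forall x, `|x| <= 1 -> `|u x| <= M) -> dual_norm u <= M.
Proof.
move=> uM; apply: ge_sup; first by have [] := dual_norm_has_sup u.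
by move=> _ [x /= x1 <-]; exact: uM.
Qed.

Lemma dual_normD (u v : dual_space) :
  dual_norm (u + v) <= dual_norm u + dual_norm v.
Proof.
apply: dual_norm_le => x x1; apply: (le_trans (ler_normD (u x) (v x))).
apply: lerD; apply: (le_trans (le_dual_norm _ x)).
  by rewrite -[leRHS]mulr1 ler_wpM2l// dual_norm_ge0.
by rewrite -[leRHS]mulr1 ler_wpM2l// dual_norm_ge0.
Qed.

Lemma dual_normZ_le (a : R) (u : dual_space) :
  dual_norm (a *: u) <= `|a| * dual_norm u.
Proof.
apply: dual_norm_le => x x1; rewrite [X in X <= _](normrM a (u x)).
rewrite ler_wpM2l//; apply: (le_trans (le_dual_norm _ x)).
by rewrite -[leRHS]mulr1 ler_wpM2l// dual_norm_ge0.
Qed.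

Lemma dual_normZ (a : R) (u : dual_space) :
  dual_norm (a *: u) = `|a| * dual_norm u.
Proof.
apply/eqP; rewrite eq_le dual_normZ_le /=.
have [->|a0] := eqVneq a 0; first by rewrite normr0 mul0r dual_norm_ge0.
have := dual_normZ_le a^-1 (a *: u).
by rewrite scalerA mulVf// scale1r normfV ler_pdivlMl// normr_gt0.
Qed.

Lemma dual_norm_eq0 (u : dual_space) : dual_norm u = 0 -> u = 0.
Proof.
move=> u0; apply/val_inj/funext => x; apply/eqP.
by rewrite -normr_le0; have := le_dual_norm u x; rewrite u0 mul0r.
Qed.

HB.instance Definition _ :=
  Lmodule_isNormed.Build R dual_space dual_normD dual_normZ dual_norm_eq0.

Lemma dual_normE (u : dual_space) : `|u| = dual_norm u.
Proof. by []. Qed.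

End DualSpace.
Arguments dual_space {R} X.

Section Operators.
Context {R : realType}.

Definition bounded_operator (V W : normedModType R) (f : V -> W) : Prop :=
  exists C : R, forall x, `|f x| <= C * `|x|.

Record linear_isomorphism (X : normedModType R) := LinearIsomorphism {
  iso_fun :> {linear X -> X} ;
  iso_inv : {linear X -> X} ;
  iso_funK : cancel iso_fun iso_inv ;
  iso_invK : cancel iso_inv iso_fun ;
  iso_fun_bounded : bounded_operator iso_fun ;
  iso_inv_bounded : bounded_operator iso_inv }.

Context {X : normedModType R}.

Lemma adjoint_subproof (Q : linear_isomorphism X) (u : dual_space X) :
  (u : X -> R^o) \o Q \in dual_pred.
Proof.
apply/asboolP; split.
  by move=> a x y /=; rewrite !linearP.
move=> x; apply: continuous_comp; last exact: dual_continuous.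
apply: bounded_linear_continuous; apply/linear_boundedP.
have [C QC] := iso_fun_bounded Q.
near=> r => y; apply: (le_trans (QC y)); rewrite ler_wpM2r//.
Unshelve. all: by end_near. Qed.

Definition adjoint (Q : linear_isomorphism X) (u : dual_space X) :
  dual_space X := DualSpace (adjoint_subproof Q u).

Definition lipschitz_continuous (K : X -> dual_space X) : Prop :=
  exists2 C : R, 0 < C & C.-lipschitz K.

Definition uniformly_monotone (K : X -> dual_space X) : Prop :=
  exists2 c : R, 0 < c &
    forall u v : X, c * `|u - v| ^+ 2 <= (K u - K v) (u - v).

Definition symmetric_operator (P : {linear X -> dual_space X}) : Prop :=
  forall eta mu : X, P eta mu = P mu eta.

Definition coercive (P : {linear X -> dual_space X}) : Prop :=
  uniformly_monotone P.

(* [pinv setT P] is the two-sided inverse of [P] when [P] is bijective, and is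
   unspecified outside the range of [P] otherwise. *)
Definition preconditioned_iteration (P : {linear X -> dual_space X})
    (Q : linear_isomorphism X) (G : X -> dual_space X) (s : R)
    (chi : dual_space X) (eta0 : X) (n : nat) : X :=
  iter n (fun eta => eta + s *: pinv setT P (adjoint Q (chi - G eta))) eta0.

End Operators.

(* Main.v *)
Require Import Defs.
From mathcomp Require Import all_boot all_order all_algebra.
From mathcomp Require Import all_classical all_reals all_analysis.
From mathcomp Require Import ring lra.

Set Implicit Arguments.
Unset Strict Implicit.
Unset Printing Implicit Defensive.

Import Order.TTheory GRing.Theory Num.Theory.
Import numFieldNormedType.Exports.

Local Open Scope classical_set_scope.
Local Open Scope ring_scope.

(** Bijectivity of [P] is the symmetric Lax-Milgram theorem: near-minimizers of
the energy show that [P] has dense range, and [P] is bounded below on a complete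
space. In the energy norm [P x x], one step of the iteration contracts: if
[e = u - v] and [P w = Q^* G u - Q^* G v], then
[P (e - s w) (e - s w) = P e e - 2 s P w e + s^2 P w w], where monotonicity
makes the middle term at least [2 s c |e|^2] while the last one is
[O(s^2 |e|^2)]. Hence the iteration converges linearly, and a suitable iterate
of the step is a Banach contraction for the original norm, whose fixed point
solves [G eta = chi]. *)

(** * Pairing and dual norm estimates *)

Lemma dualBE (R : realType) (X : normedModType R) (u v : dual_space X) (x : X) :
  (u - v) x = u x - v x :> R.
Proof. by []. Qed.

Lemma dual_le_norm (R : realType) (X : normedModType R) (u : dual_space X)
  (x : X) : u x <= `|u| * `|x| :> R.
Proof. exact: le_trans (ler_norm _) (le_dual_norm u x). Qed.

(** Testing at [-x] as well turns the one-sided bound into one on the absolute value. *)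
Lemma dual_norm_bound (R : realType) (X : normedModType R) (u : dual_space X)
  (M : R) :
  0 <= M -> (forall x : X, (u x : R) <= M * `|x|) -> `|u| <= M.
Proof.
move=> M0 uM; rewrite dual_normE; apply: dual_norm_le => x x1.
have Mx : M * `|x| <= M by rewrite -[leRHS]mulr1 ler_wpM2l.
rewrite ler_norml; apply/andP; split.
  by rewrite lerNl -linearN; apply: le_trans Mx; rewrite -(normrN x); exact: uM.
exact: le_trans Mx.
Qed.

(** * Coercive operators and the symmetric Lax-Milgram theorem *)

Lemma coercive_form_ge (R : realType) (X : normedModType R)
  (P : {linear X -> dual_space X}) : coercive P ->
  exists2 c : R, 0 < c & forall x : X, c * `|x| ^+ 2 <= (P x x : R).
Proof.
move=> [c c0 Pc]; exists c => // x.
by have := Pc x 0; rewrite (linear0 P) !subr0.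
Qed.

Lemma bounded_operator_gt0 (R : realType) (V W : normedModType R) (f : V -> W) :
  bounded_operator f -> exists2 C : R, 0 < C & forall x, `|f x| <= C * `|x|.
Proof.
move=> [C fC]; exists (`|C| + 1); first by rewrite ltr_wpDl.
move=> x; apply: (le_trans (fC x)); rewrite ler_wpM2r//.
by rewrite (le_trans (ler_norm _))// lerDl.
Qed.

(* Near-minimizers [x] of the energy [P x x - 2 * u x] satisfy the
   Euler-Lagrange equation [P x = u] approximately. *)
Lemma coercive_dense_range (R : realType) (X : normedModType R)
    (P : {linear X -> dual_space X}) (u : dual_space X) (e : R) :
  bounded_operator P -> symmetric_operator P -> coercive P -> 0 < e ->
  exists x : X, `|P x - u| <= e.
Proof.
move=> /bounded_operator_gt0[C C0 PC] symP /coercive_form_ge[c c0 Pc] e0.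
pose J (x : X) : R := P x x - 2 * u x.
have has_infJ : has_inf (range J).
  split; first by exists (J 0), 0.
  (* Completing the square in [|x|]: this is the minimum of [c * y ^+ 2 - 2 * |u| * y] over real
     [y]. *)
  exists (- (`|u| ^+ 2 / c)) => _ [x _ <-]; rewrite /J.
  have := Pc x; have := dual_le_norm u x.
  move: (P x x) (u x) `|x| `|u| => a b y z bzy cya.
  have -> : - (z ^+ 2 / c) = c * y ^+ 2 - 2 * (z * y) - (c * y - z) ^+ 2 / c.
    by field; rewrite gt_eqF.
  have : 0 <= (c * y - z) ^+ 2 / c by rewrite divr_ge0 ?sqr_ge0 ?ltW.
  lra.
have d0 : 0 < e ^+ 2 / C by rewrite divr_gt0// exprn_gt0.
have [_ [x _ <-] Jx] := inf_adherent d0 has_infJ.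
exists x; apply: dual_norm_bound; first exact: ltW.
move=> h; rewrite dualBE.
have [->|h0] := eqVneq h 0; first
  by rewrite [P x 0]linear0 [u 0]linear0 normr0 mulr0 subrr.
have h_gt0 : 0 < `|h| by rewrite normr_gt0.
(* This step length makes the quadratic term [t ^+ 2 * P h h] at most [e ^+ 2 / C], the tolerance of
   the near-minimizer; the linear term then yields exactly [e * |h|]. *)
pose t : R := - (e / (C * `|h|)).
have Jxt : inf (range J) <= J (x + t *: h).
  by apply: ge_inf; [case: has_infJ | exists (x + t *: h)].
have : J (x + t *: h) = J x + 2 * t * (P x h - u h) + t ^+ 2 * P h h.
  have PD z : P (x + t *: h) z = P x z + t * P h z :> R.
    by rewrite linearD linearZ.
  have uD (v : dual_space X) : v (x + t *: h) = v x + t * v h :> R.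
    by rewrite linearD linearZ.
  by rewrite /J !(uD, PD) [P h x]symP; ring.
have Phh : (P h h : R) <= C * `|h| ^+ 2.
  apply: (le_trans (dual_le_norm _ _)).
  by rewrite expr2 mulrA ler_wpM2r.
move: Jx Jxt Phh; rewrite {}/t.
move: (J _) (J x) (inf _) (P x h) (u h) (P h h) => j' j i p b a ji ij' aC jE.
suff : e / (C * `|h|) * (p - b) <= e / (C * `|h|) * (e * `|h|).
  by rewrite ler_pM2l// divr_gt0// mulr_gt0.
have -> : e / (C * `|h|) * (e * `|h|) = e ^+ 2 / C.
  by field; rewrite !gt_eqF.
have : (e / (C * `|h|)) ^+ 2 * a <= (e / (C * `|h|)) ^+ 2 * (C * `|h| ^+ 2).
  by rewrite ler_wpM2l// sqr_ge0.
have -> : (e / (C * `|h|)) ^+ 2 * (C * `|h| ^+ 2) = e ^+ 2 / C.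
  by field; rewrite !gt_eqF.
rewrite sqrrN in jE.
move: (e / (C * _)) (e ^+ 2 / C) jE ji ij' => t d.
lra.
Qed.

Lemma coercive_lower_bound (R : realType) (X : normedModType R)
    (P : {linear X -> dual_space X}) : coercive P ->
  exists2 c : R, 0 < c & forall x : X, c * `|x| <= `|P x|.
Proof.
move=> /coercive_form_ge[c c0 Pc]; exists c => // x.
have [->|x0] := eqVneq x 0; first by rewrite normr0 mulr0.
rewrite -(@ler_pM2r _ `|x|) ?normr_gt0// -mulrA -expr2.
exact: le_trans (Pc x) (dual_le_norm _ _).
Qed.

(** The lower bound [c * |x| <= |P x|] gives injectivity and makes approximate preimages of [u] a
    Cauchy sequence, whose limit is a preimage by continuity of [P]. *)
Lemma coercive_bijective (R : realType) (X : completeNormedModType R)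
    (P : {linear X -> dual_space X}) :
  bounded_operator P -> symmetric_operator P -> coercive P -> bijective P.
Proof.
move=> bP symP cP; have [c c0 Pc] := coercive_lower_bound cP.
have injP : injective P.
  move=> x y /eqP; rewrite -subr_eq0 -linearB => /eqP Pxy0.
  have := Pc (x - y); rewrite Pxy0 normr0 pmulr_rle0// normr_le0 subr_eq0.
  by move=> /eqP.
rewrite -setTT_bijective; split => // [x y _ _ //|u _]; first exact: injP.
have /choice[x Px] : forall n, exists x : X, `|P x - u| <= harmonic n.
  by move=> n; apply: coercive_dense_range => //=.
have Pxu : P (x n) @[n --> \oo] --> u.
  apply/cvgrPdist_le => e e0.
  near=> n; rewrite distrC (le_trans (Px n))// ltW//.
  by near: n; exact: near_infty_natSinv_lt (PosNum e0).
have cvgx : cvgn x.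
  apply/cauchy_cvgP/cauchy_ballP => e e0.
  have /cvg_cauchy/cauchy_ballP/(_ (c * e)) : cvgn (P \o x).
    by apply/cvg_ex; exists u.
  move=> /(_ (mulr_gt0 c0 e0)).
  rewrite !near_simpl; apply: filterS => -[n m] /=.
  rewrite -!ball_normE /= -linearB => /(le_lt_trans (Pc _)).
  by rewrite ltr_pM2l.
have cP' : continuous P.
  apply: bounded_linear_continuous; apply/linear_boundedP.
  have [C PC] := bP.
  by near=> r => y; apply: (le_trans (PC y)); rewrite ler_wpM2r.
exists (limn x) => //.
apply: (@norm_cvg_unique _ _ (P (x n) @[n --> \oo])) => //.
by apply: continuous_cvg => //; exact: cP'.
Unshelve. all: by end_near. Qed.

(** * Cancelling the inverse of [P] and the adjoint of [Q] *)

Lemma bijective_pinvK (T : pointedType) (U : Type) (f : T -> U) :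
  bijective f -> cancel (pinv setT f) f.
Proof.
by move=> [g _ gK] y; apply: pinvK; rewrite inE; exists (g y).
Qed.

Lemma adjointB (R : realType) (X : normedModType R)
    (Q : linear_isomorphism X) (u v : dual_space X) :
  adjoint Q (u - v) = adjoint Q u - adjoint Q v.
Proof. exact/val_inj. Qed.

(** [Q] is onto. Hence a vanishing preconditioned residual means a solved equation. *)
Lemma adjoint_eq0 (R : realType) (X : normedModType R)
    (Q : linear_isomorphism X) (u : dual_space X) : adjoint Q u = 0 <-> u = 0.
Proof.
split=> [Qu0|->]; apply/val_inj/funext => x //=.
have : adjoint Q u (iso_inv Q x) = 0 by rewrite Qu0.
by rewrite /= iso_invK.
Qed.

(** * Contraction of the iteration and its fixed points *)

Lemma energy_contraction (R : realType) (X : normedModType R)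
    (P : {linear X -> dual_space X}) (K : X -> dual_space X) :
  bounded_operator P -> symmetric_operator P -> coercive P ->
  lipschitz_continuous K -> uniformly_monotone K ->
  \forall s \near (0 : R)^'+, exists2 q : R, 0 < q < 1 &
    forall u v w : X, P w = K u - K v ->
      (P (u - v - s *: w) (u - v - s *: w) : R) <= q * P (u - v) (u - v).
Proof.
move=> /bounded_operator_gt0[B B0 PB] symP /coercive_form_ge[p p0 Pp].
move=> [C C0 lipK] [c c0 monoK].
near=> s.
have s0 : 0 < s by near: s; exact: nbhs_right_gt.
(* This bounds the quadratic term by [s * c * |e| ^+ 2], half of what monotonicity gains. *)
have s_small : s * C ^+ 2 / p <= c.
  rewrite -mulrA -ler_pdivlMr ?divr_gt0 ?exprn_gt0//; apply: ltW.
  by near: s; apply: nbhs_right_lt; do ?apply: divr_gt0 => //; apply: exprn_gt0.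
have scB : s * c / B < 1.
  rewrite -mulrA -ltr_pdivlMr ?divr_gt0// mul1r.
  by near: s; apply: nbhs_right_lt; rewrite invr_gt0 divr_gt0.
(* The other half of the gain is at least [s * c / B * P e e], because [P e e <= B * |e| ^+ 2]. *)
exists (1 - s * c / B).
  by rewrite subr_gt0 scB/= ltrBlDr ltrDl !mulr_gt0 ?invr_gt0.
move=> u v w Pw; set e := u - v.
have Pee : (P e e : R) <= B * `|e| ^+ 2.
  by rewrite (le_trans (dual_le_norm _ _))// expr2 mulrA ler_wpM2r.
have Kuv : `|K u - K v| <= C * `|e| by exact: (lipK (u, v)).
have Pwe : c * `|e| ^+ 2 <= P w e by rewrite Pw; exact: monoK.
have Pww : (P w w : R) <= C * `|e| * `|w|.
  by rewrite (le_trans (dual_le_norm _ _))// Pw ler_wpM2r.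
have w_le : p * `|w| <= C * `|e|.
  have [->|w0] := eqVneq w 0; first by rewrite normr0 mulr0 mulr_ge0// ltW.
  rewrite -(@ler_pM2r _ `|w|) ?normr_gt0// -mulrA -expr2.
  exact: le_trans (Pp w) Pww.
have {}Pww : (P w w : R) <= C ^+ 2 / p * `|e| ^+ 2.
  apply: (le_trans Pww).
  have -> : C ^+ 2 / p * `|e| ^+ 2 = C * `|e| * (C * `|e| / p).
    by field; rewrite gt_eqF.
  by rewrite ler_wpM2l ?mulr_ge0 ?(ltW C0)// ler_pdivlMr// mulrC.
have -> : P (e - s *: w) (e - s *: w) =
    P e e - 2 * s * P w e + s ^+ 2 * P w w :> R.
  have PB' z : P (e - s *: w) z = P e z - s * P w z :> R.
    by rewrite linearB linearZ.
  have uB (f : dual_space X) : f (e - s *: w) = f e - s * f w :> R.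
    by rewrite linearB linearZ.
  by rewrite !(PB', uB) [P e w]symP; ring.
have sPwe : s * (c * `|e| ^+ 2) <= s * P w e by rewrite ler_pM2l.
have sPww : s ^+ 2 * P w w <= s * (c * `|e| ^+ 2) :> R.
  rewrite expr2 -mulrA ler_pM2l//.
  apply: (@le_trans _ _ (s * (C ^+ 2 / p * `|e| ^+ 2))).
    by rewrite ler_pM2l.
  by rewrite mulrA [s * _]mulrA ler_wpM2r// sqr_ge0.
have sPee : s * c / B * P e e <= s * (c * `|e| ^+ 2) :> R.
  have -> : s * (c * `|e| ^+ 2) = s * c / B * (B * `|e| ^+ 2).
    by field; rewrite gt_eqF.
  by rewrite ler_wpM2l// !mulr_ge0 ?invr_ge0// ltW.
rewrite mulrBl mul1r.
move: (P e e) (P w e) (P w w) sPwe sPww sPee => a b d.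
move: (s * (c * _)) (s * c / B * a) => k l; lra.
Unshelve. all: by end_near. Qed.

(** The equivalence [p * |x| ^+ 2 <= P x x <= B * |x| ^+ 2] carries the energy contraction over to
    the norm, at the price of the factor [sqrt (B / p)]; the roots appear because the energy is
    quadratic. *)
Lemma preconditioned_iteration_contractive (R : realType)
    (X : completeNormedModType R)
    (P : {linear X -> dual_space X}) (Q : linear_isomorphism X)
    (G : X -> dual_space X) :
  bounded_operator P -> symmetric_operator P -> coercive P ->
  lipschitz_continuous (adjoint Q \o G) ->
  uniformly_monotone (adjoint Q \o G) ->
  \forall s \near (0 : R)^'+, exists C L : R, [/\ 0 < C, 0 < L < 1 &
    forall (chi : dual_space X) (u v : X) (n : nat),
      `|preconditioned_iteration P Q G s chi u n -
        preconditioned_iteration P Q G s chi v n| <= C * L ^+ n * `|u - v|].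
Proof.
move=> bP symP cP lipK monoK.
have := energy_contraction bP symP cP lipK monoK.
apply: filterS => s [q /andP[q0 q1] Pq].
have [B B0 PB] := bounded_operator_gt0 bP.
have [p p0 Pp] := coercive_form_ge cP.
exists (Num.sqrt (B / p)), (Num.sqrt q); split.
- by rewrite sqrtr_gt0 divr_gt0.
- by rewrite sqrtr_gt0 q0 /= -[ltRHS]sqrtr1 ltr_sqrt.
move=> chi u v n.
have surjP := bijective_pinvK (coercive_bijective bP symP cP).
set U := preconditioned_iteration P Q G s chi u.
set V := preconditioned_iteration P Q G s chi v.
have energy_le : (P (U n - V n) (U n - V n) : R) <= q ^+ n * P (u - v) (u - v).
  elim: n => [|n IHn]; first by rewrite expr0 mul1r.
  rewrite exprS -mulrA; apply: le_trans (ler_wpM2l (ltW q0) IHn).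
  pose F (x : X) := pinv setT P (adjoint Q (chi - G x)).
  (* The order of [F (V n)] and [F (U n)] absorbs the sign of the residual; [chi] cancels in the
     difference. *)
  have -> : U n.+1 - V n.+1 = U n - V n - s *: (F (V n) - F (U n)).
    rewrite /U /V /preconditioned_iteration !iterS -/(F _) -/(F _).
    by rewrite -scalerN opprB scalerBr opprD addrACA.
  apply: Pq; rewrite linearB !surjP !adjointB.
  by rewrite opprB addrC addrA subrK.
rewrite -ler_sqr ?nnegrE ?mulr_ge0 ?sqrtr_ge0 ?exprn_ge0 ?sqrtr_ge0//.
rewrite !exprMn -exprM mulnC exprM.
rewrite !sqr_sqrtr ?divr_ge0 ?(ltW B0) ?(ltW p0) ?(ltW q0)//.
rewrite -(ler_pM2l p0); apply: (le_trans (Pp _)); apply: (le_trans energy_le).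
have -> : p * (B / p * q ^+ n * `|u - v| ^+ 2) = q ^+ n * (B * `|u - v| ^+ 2).
  by field; rewrite gt_eqF.
rewrite ler_wpM2l ?exprn_ge0 ?(ltW q0)//.
by rewrite (le_trans (dual_le_norm _ _))// expr2 mulrA ler_wpM2r.
Qed.

(** [C] may exceed 1, so [T] itself need not contract, but [iter k T] does once [C * L ^+ k] is
    small. As [T] commutes with it, [T] maps its unique fixed point to itself. *)
Lemma iterated_contraction_fixpoint (R : realType) (X : completeNormedModType R)
    (T : X -> X) (C L : R) :
  0 < L < 1 ->
  (forall (u v : X) (n : nat),
    `|iter n T u - iter n T v| <= C * L ^+ n * `|u - v|) ->
  exists p : X, T p = p.
Proof.
move=> /andP[L0 L1] TL.
have /cvgrPdist_lt/(_ 1 ltr01)[k _ /(_ k (leqnn k))] :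
    geometric C L n @[n --> \oo] --> (0 : R).
  by apply: cvg_geometric; rewrite gtr0_norm.
rewrite sub0r normrN /= => CL1.
(* The absolute value is taken since the sign of [C] is not prescribed. *)
pose q := NngNum (normr_ge0 (C * L ^+ k)).
have ctr : is_contraction (totalfun (iter k T)).
  exists q; split => // -[x y] _ /=; apply: (le_trans (TL _ _ _)).
  by rewrite ler_wpM2r// ler_norm.
have [p _ /= Tp] := banach_fixed_point ctr closedT (ex_intro _ 0 I).
exists p; apply/esym.
apply: (contraction_fixpoint_unique ctr) => //=.
by rewrite -[RHS]/(iter k T (T p)) -iterSr iterS [in LHS]Tp.
Qed.

Theorem theorem1 (R : realType) (X : completeNormedModType R)
    (dot : {dot X for idfun})
    (norm_dot : forall x : X, `|x| ^+ 2 = dot x x)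
    (G : X -> dual_space X) (Q : linear_isomorphism X)
    (QG_lipschitz : lipschitz_continuous (adjoint Q \o G))
    (QG_monotone : uniformly_monotone (adjoint Q \o G))
    (P : {linear X -> dual_space X})
    (P_bounded : bounded_operator P)
    (P_symmetric : symmetric_operator P)
    (P_coercive : coercive P) :
  [/\ bijective P,
      bijective G &
      forall (chi : dual_space X) (eta0 eta : X), G eta = chi ->
      \forall s \near (0 : R)^'+,
        preconditioned_iteration P Q G s chi eta0 n @[n --> \oo] --> eta /\
        exists C L : R, [/\ 0 < C, 0 < L < 1 &
          forall n : nat,
            `|preconditioned_iteration P Q G s chi eta0 n - eta|
              <= C * L ^+ n * `|eta0 - eta|] ].
Proof.
have bijP := coercive_bijective P_bounded P_symmetric P_coercive.
have surjP := bijective_pinvK bijP.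
have contr := preconditioned_iteration_contractive P_bounded P_symmetric
  P_coercive QG_lipschitz QG_monotone.
split => //.
- rewrite -setTT_bijective; split => // [u v _ _ Guv|chi _].
    (* Equal images reduce monotonicity to [c * |u - v| ^+ 2 <= 0]. *)
    have [c c0 /(_ u v)] := QG_monotone.
    rewrite /= Guv subrr pmulr_rle0// => /(conj (sqr_ge0 `|u - v|))/andP.
    by rewrite -eq_le eq_sym sqrf_eq0 normr_eq0 subr_eq0 => /eqP.
  (* For surjectivity, fix one admissible step size. At a fixed point the increment vanishes, and
     [s > 0] forces the preconditioned residual to be zero. *)
  have [s [s0 [C [L [_ L01 TL]]]]] : exists s : R, 0 < s /\ _ :=
    filter_ex (filterI (nbhs_right_gt 0) contr).
  have [eta] := iterated_contraction_fixpoint L01 (TL chi).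
  rewrite -[RHS]addr0 => /addrI/eqP; rewrite scaler_eq0 gt_eqF//= => /eqP eta0.
  exists eta => //.
  move: eta0 => /(congr1 P); rewrite linear0 surjP.
  by move=> /adjoint_eq0/eqP; rewrite subr_eq0 => /eqP.
move=> chi eta0 eta Geta; move: contr; apply: filterS => s [C [L [C0 L01 TL]]].
(* The solution is stationary, so the error is the distance between two runs of the iteration. *)
have fix_eta n : preconditioned_iteration P Q G s chi eta n = eta.
  elim: n => // n IHn; rewrite /preconditioned_iteration iterS.
  rewrite -/(preconditioned_iteration _ _ _ _ _ _ _) IHn Geta subrr.
  have -> : adjoint Q 0 = 0 by apply/adjoint_eq0.
  have -> : pinv setT P 0 = 0.
    by apply: (bij_inj bijP); rewrite linear0 surjP.
  by rewrite scaler0 addr0.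
have eta_le n : `|preconditioned_iteration P Q G s chi eta0 n - eta| <=
    C * L ^+ n * `|eta0 - eta|.
  by rewrite -[in leLHS](fix_eta n).
split; last by exists C, L.
apply: (@cvg_sub0 _ _ _ _ _ _ (cst eta)); last exact: cvg_cst.
apply: norm_cvg0.
apply: (@squeeze_cvgr _ _ _ _ (cst 0) (geometric (C * `|eta0 - eta|) L)).
- by apply: nearW => n; rewrite normr_ge0 /= mulrAC; exact: eta_le.
- exact: cvg_cst.
- by apply: cvg_geometric; case/andP: L01 => ? ?; rewrite gtr0_norm.
Qed.
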